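(* Let $\phi : \mathfrak{a} \to \mathfrak{c}$ and $\psi : \mathfrak{b} \to \mathfrak{d}$ be $k$-linear functors between small $k$-linear categories, and let $\mathcal{T}_{\mathfrak{a}}, \mathcal{T}_{\mathfrak{b}}, \mathcal{T}_{\mathfrak{c}}, \mathcal{T}_{\mathfrak{d}}$ be localizing cover systems on the respective categories. If $\phi : (\mathfrak{a}, \mathcal{T}_{\mathfrak{a}}) \to (\mathfrak{c}, \mathcal{T}_{\mathfrak{c}})$ and $\psi : (\mathfrak{b}, \mathcal{T}_{\mathfrak{b}}) \to (\mathfrak{d}, \mathcal{T}_{\mathfrak{d}})$ are continuous, then so is $\phi \otimes \psi : (\mathfrak{a} \otimes \mathfrak{b}, \mathcal{T}_{\mathfrak{a}} \boxtimes \mathcal{T}_{\mathfrak{b}}) \to (\mathfrak{c} \otimes \mathfrak{d}, \mathcal{T}_{\mathfrak{c}} \boxtimes \mathcal{T}_{\mathfrak{d}})$.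
   Context: $k$ is a commutative ring. For a small $k$-linear category $\mathfrak{a}$, $\mathrm{Mod}(\mathfrak{a})$ is the category of $k$-linear functors $\mathfrak{a}^{\mathrm{op}} \to \mathrm{Mod}(k)$. The tensor product $\mathfrak{a} \otimes \mathfrak{b}$ has objects the pairs $(A,B)$ and $(\mathfrak{a} \otimes \mathfrak{b})((A',B'),(A,B)) = \mathfrak{a}(A',A) \otimes_k \mathfrak{b}(B',B)$; $\phi \otimes \psi$ is the induced functor. A sieve on $A \in \mathfrak{a}$ is a submodule $R \subseteq \mathfrak{a}(-,A)$; for $f : A' \to A$, $f^{-1}R = \{g \mid fg \in R\}$. A cover system $\mathcal{T}$ on $\mathfrak{a}$ specifies for every $A$ a collection $\mathcal{T}(A)$ of sieves on $A$ (the covers). It is localizing if $\mathfrak{a}(-,A) \in \mathcal{T}(A)$ for all $A$ (identity axiom) and $R \in \mathcal{T}(A)$, $f : A' \to A$ imply $f^{-1}R \in \mathcal{T}(A')$ (pullback axiom). It is a topology if moreover the glueing axiom holds: if $R \in \mathcal{T}(A)$ and $S$ is a sieve on $A$ with $f^{-1}S \in \mathcal{T}(A')$ for all $f \in R(A')$, then $S \in \mathcal{T}(A)$. A sheaf on $(\mathfrak{a}, \mathcal{T})$ is $F \in \mathrm{Mod}(\mathfrak{a})$ such that $F(A) \cong \mathrm{Hom}(\mathfrak{a}(-,A),F) \to \mathrm{Hom}(R,F)$ is an isomorphism for all $A$ and $R \in \mathcal{T}(A)$. The functor $\phi : (\mathfrak{a}, \mathcal{T}_{\mathfrak{a}}) \to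 (\mathfrak{c}, \mathcal{T}_{\mathfrak{c}})$ is continuous if $\phi^{\ast} : \mathrm{Mod}(\mathfrak{c}) \to \mathrm{Mod}(\mathfrak{a})$, $F \mapsto F \circ \phi$, sends sheaves to sheaves. For sieves $R$ on $A$ and $S$ on $B$, $R \boxtimes S$ is the image of $R \otimes S \to (\mathfrak{a} \otimes \mathfrak{b})(-,(A,B))$, where $(R\otimes S)(A',B') = R(A')\otimes_k S(B')$. $\mathcal{T}_{\mathfrak{a}} \boxtimes \mathcal{T}_{\mathfrak{b}}$ is the smallest topology on $\mathfrak{a} \otimes \mathfrak{b}$ containing all sieves $R \boxtimes \mathfrak{b}(-,B)$ with $R \in \mathcal{T}_{\mathfrak{a}}(A)$ and all sieves $\mathfrak{a}(-,A) \boxtimes S$ with $S \in \mathcal{T}_{\mathfrak{b}}(B)$ ($A \in \mathfrak{a}$, $B \in \mathfrak{b}$). *)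

(* Defs.v *)
From HB Require Import structures.
From mathcomp Require Import all_boot all_algebra.
From mathcomp Require Import boolp classical_sets.

Set Implicit Arguments.
Unset Strict Implicit.
Unset Printing Implicit Defensive.

Import GRing.Theory.
Local Open Scope classical_set_scope.
Local Open Scope quotient_scope.
Local Open Scope ring_scope.

(** * Tensor product of modules over a commutative ring *)

Definition bilin (k : comPzRingType) (M N P : lmodType k) (f : M -> N -> P) :=
  (forall m, linear (f m)) /\ (forall n, linear (f^~ n)).

Section Tensor.
Variables (k : comPzRingType) (M N : lmodType k).

(* A list of pairs stands for the formal sum of the symbols m (x) n.  Since
   there are no formal opposites, [tens0l] is needed among the generators; the
   opposite of m (x) n in the quotient is then (- m) (x) n. *)
Inductive tens_rel : seq (M * N) -> seq (M * N) -> Prop :=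
| tens_refl s : tens_rel s s
| tens_sym s t : tens_rel s t -> tens_rel t s
| tens_trans t s u : tens_rel s t -> tens_rel t u -> tens_rel s u
| tens_cat s s' t t' :
    tens_rel s s' -> tens_rel t t' -> tens_rel (s ++ t) (s' ++ t')
| tens_catC s t : tens_rel (s ++ t) (t ++ s)
| tens0l n : tens_rel [:: (0, n)] [::]
| tensDl m m' n : tens_rel [:: (m + m', n)] [:: (m, n); (m', n)]
| tensDr m n n' : tens_rel [:: (m, n + n')] [:: (m, n); (m, n')]
| tensZ x m n : tens_rel [:: (x *: m, n)] [:: (m, x *: n)].

Definition tens_relb (s t : seq (M * N)) : bool := `[< tens_rel s t >].

Lemma tens_relb_equiv : equiv_class_of tens_relb.
Proof.
split=> [s|s t|t s u].
- exact/asboolP/tens_refl.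
- by apply/asboolP/asboolP; apply: tens_sym.
- by move=> /asboolP st /asboolP tu; apply/asboolP; apply: tens_trans tu.
Qed.

Canonical tens_equiv := EquivRelPack tens_relb_equiv.

Definition tens := {eq_quot tens_equiv}.
HB.instance Definition _ := Choice.on tens.

Definition tens_cls (s : seq (M * N)) : tens := \pi_({eq_quot tens_equiv}) s.
Definition tens_rep (t : tens) : seq (M * N) := repr (t : {eq_quot tens_equiv}).

Lemma tens_repK t : tens_cls (tens_rep t) = t.
Proof. exact: reprK. Qed.

Lemma tens_clsP s t : tens_cls s = tens_cls t <-> tens_rel s t.
Proof.
split=> [/eqP|st].
  by rewrite /tens_cls piE => /asboolP.
by apply/eqP; rewrite /tens_cls piE; apply/asboolP.
Qed.

Lemma tens_rep_cls s : tens_rel (tens_rep (tens_cls s)) s.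
Proof. by apply/tens_clsP; rewrite tens_repK. Qed.

Definition tens_add (t u : tens) := tens_cls (tens_rep t ++ tens_rep u).

Definition tens_seqZ (x : k) (s : seq (M * N)) := [seq (x *: p.1, p.2) | p <- s].
Definition tens_scale (x : k) (t : tens) := tens_cls (tens_seqZ x (tens_rep t)).

Lemma tens_add_cls s t : tens_add (tens_cls s) (tens_cls t) = tens_cls (s ++ t).
Proof. by apply/tens_clsP/tens_cat; apply: tens_rep_cls. Qed.

Lemma tens_seqZ_rel x s t :
  tens_rel s t -> tens_rel (tens_seqZ x s) (tens_seqZ x t).
Proof.
elim=> {s t} /=; rewrite /tens_seqZ.
- by move=> s; apply: tens_refl.
- by move=> s t _; apply: tens_sym.
- by move=> t s u _ st _; apply: tens_trans.
- by move=> s s' t t' _ ss _ tt; rewrite !map_cat; apply: tens_cat.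
- by move=> s t; rewrite !map_cat; apply: tens_catC.
- by move=> n; rewrite /= scaler0; apply: tens0l.
- by move=> m m' n; rewrite /= scalerDr; apply: tensDl.
- by move=> m n n'; apply: tensDr.
- by move=> y m n; rewrite /= scalerA mulrC -scalerA; apply: tensZ.
Qed.

Lemma tens_scale_cls x s : tens_scale x (tens_cls s) = tens_cls (tens_seqZ x s).
Proof. by apply/tens_clsP/tens_seqZ_rel/tens_rep_cls. Qed.

Lemma tens_addA : associative tens_add.
Proof.
move=> t u v; rewrite -(tens_repK t) -(tens_repK u) -(tens_repK v).
by rewrite !tens_add_cls catA.
Qed.

Lemma tens_addC : commutative tens_add.
Proof. by move=> t u; apply/tens_clsP/tens_catC. Qed.

Lemma tens_add0 : left_id (tens_cls [::]) tens_add.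
Proof. by move=> t; rewrite -(tens_repK t) tens_add_cls. Qed.

HB.instance Definition _ :=
  GRing.isNmodule.Build tens tens_addA tens_addC tens_add0.

Lemma tens_scaleA x y t : tens_scale x (tens_scale y t) = tens_scale (x * y) t.
Proof.
rewrite -(tens_repK t) !tens_scale_cls /tens_seqZ -map_comp.
by congr tens_cls; apply: eq_map => p /=; rewrite scalerA.
Qed.

Lemma tens_scale0 t : tens_scale 0 t = 0.
Proof.
rewrite -(tens_repK t) tens_scale_cls; apply/tens_clsP.
elim: (tens_rep t) => [|p s IHs] /=; first exact: tens_refl.
by rewrite scale0r -cat1s -[[::]]/([::] ++ [::]); apply: tens_cat IHs; apply: tens0l.
Qed.

Lemma tens_scale1 : left_id 1 tens_scale.
Proof.
move=> t; rewrite -(tens_repK t) tens_scale_cls /tens_seqZ.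
by congr tens_cls; apply: map_id_in => -[m n] _ /=; rewrite scale1r.
Qed.

Lemma tens_scaleDr : right_distributive tens_scale +%R.
Proof.
move=> x t u; rewrite -(tens_repK t) -(tens_repK u) [_ + _]tens_add_cls.
by rewrite !tens_scale_cls [_ + _]tens_add_cls /tens_seqZ map_cat.
Qed.

Lemma tens_scaleDl t : {morph tens_scale^~ t : x y / x + y}.
Proof.
move=> x y; rewrite -(tens_repK t) /= !tens_scale_cls [RHS]tens_add_cls.
apply/tens_clsP; elim: (tens_rep t) => [|p s IHs] /=; first exact: tens_refl.
rewrite scalerDl -cat1s; apply: tens_trans (tens_cat (tensDl _ _ _) IHs) _.
rewrite -[X in tens_rel X _]cat1s -[X in tens_rel _ X]cat1s.
apply: tens_cat (tens_refl _) _.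
rewrite -cat1s -[X in tens_rel _ (_ ++ X)]cat1s !catA.
exact: tens_cat (tens_catC _ _) (tens_refl _).
Qed.

HB.instance Definition _ := GRing.Nmodule_isLSemiModule.Build k tens
  tens_scaleA tens_scale0 tens_scale1 tens_scaleDr tens_scaleDl.
HB.instance Definition _ := GRing.LSemiModule_isLmodule.Build k tens.

Definition tpure (m : M) (n : N) : tens := tens_cls [:: (m, n)].

Lemma tpure_bilin : bilin tpure.
Proof.
split=> [m x n n'|n x m m'].
  rewrite [x *: tpure _ _]tens_scale_cls [RHS]tens_add_cls; apply/tens_clsP.
  apply: tens_trans (tensDr _ _ _) _.
  rewrite -cat1s; apply: (tens_cat (s' := [:: _])) (tens_refl _).
  exact/tens_sym/tensZ.
rewrite [x *: tpure _ _]tens_scale_cls [RHS]tens_add_cls; apply/tens_clsP.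
exact: tensDl.
Qed.

Lemma tens_ind (P : tens -> Prop) : P 0 ->
  (forall m n t, P t -> P (tpure m n + t)) -> forall t, P t.
Proof.
move=> P0 PD t; rewrite -(tens_repK t).
elim: (tens_rep t) => [//|[m n] s IHs].
by rewrite -cat1s -tens_add_cls; apply: PD.
Qed.

(* Only meaningful for bilinear f, see [tliftE]. *)
Definition tlift (P : lmodType k) (f : M -> N -> P) (t : tens) : P :=
  \sum_(p <- tens_rep t) f p.1 p.2.

Section Lift.
Variables (P : lmodType k) (f : M -> N -> P).
Hypothesis fbilin : bilin f.

Lemma bilin_rules :
  [/\ forall n, f 0 n = 0, forall m m' n, f (m + m') n = f m n + f m' n,
      forall m n n', f m (n + n') = f m n + f m n',
      forall x m n, f (x *: m) n = x *: f m n &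
      forall x m n, f m (x *: n) = x *: f m n].
Proof.
have [fr fl] := fbilin.
have f0l n : f 0 n = 0.
  by have := fl n (-1) 0 0; rewrite /= scaleN1r oppr0 add0r scaleN1r addNr.
have f0r m : f m 0 = 0.
  by have := fr m (-1) 0 0; rewrite /= scaleN1r oppr0 add0r scaleN1r addNr.
split=> // [m m' n|m n n'|x m n|x m n].
- by have := fl n 1 m m'; rewrite /= !scale1r.
- by have := fr m 1 n n'; rewrite /= !scale1r.
- by have := fl n x m 0; rewrite /= f0l !addr0.
- by have := fr m x n 0; rewrite /= f0r !addr0.
Qed.

Lemma tens_rel_sum s t : tens_rel s t ->
  \sum_(p <- s) f p.1 p.2 = \sum_(p <- t) f p.1 p.2.
Proof.
have [f0l fDl fDr fZl fZr] := bilin_rules.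
elim=> {s t} //.
- by move=> t s u _ -> _.
- by move=> s s' t t' _ ss _ tt; rewrite !big_cat /= ss tt.
- by move=> s t; rewrite !big_cat /= addrC.
- by move=> n; rewrite big_cons !big_nil /= f0l addr0.
- by move=> m m' n; rewrite !big_cons !big_nil /= fDl !addr0.
- by move=> m n n'; rewrite !big_cons !big_nil /= fDr !addr0.
- by move=> x m n; rewrite !big_cons !big_nil /= fZl fZr.
Qed.

Lemma tlift_cls s : tlift f (tens_cls s) = \sum_(p <- s) f p.1 p.2.
Proof. exact/tens_rel_sum/tens_rep_cls. Qed.

Lemma tliftE m n : tlift f (tpure m n) = f m n.
Proof. by rewrite tlift_cls big_cons big_nil addr0. Qed.

Lemma tlift_linear : linear (tlift f).
Proof.
have [_ _ _ fZl _] := bilin_rules.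
move=> x t u; rewrite -(tens_repK t) -(tens_repK u).
rewrite [x *: tens_cls _]tens_scale_cls [_ + _]tens_add_cls !tlift_cls.
rewrite big_cat big_map /= scaler_sumr; congr (_ + _).
by apply: eq_bigr => p _; rewrite fZl.
Qed.

End Lift.

Lemma tlift_unique (P : lmodType k) (g h : tens -> P) : linear g -> linear h ->
  (forall m n, g (tpure m n) = h (tpure m n)) -> g =1 h.
Proof.
move=> gl hl gh.
have lin0 (u : tens -> P) : linear u -> u 0 = 0.
  by move=> ul; have := ul (-1) 0 0; rewrite scaleN1r oppr0 add0r scaleN1r addNr.
have linD (u : tens -> P) x y : linear u -> u (x + y) = u x + u y.
  by move=> ul; have := ul 1 x y; rewrite !scale1r.
elim/tens_ind=> [|m n t IHt]; first by rewrite !lin0.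
by rewrite !linD // gh IHt.
Qed.

End Tensor.

Definition tmap (k : comPzRingType) (M N M' N' : lmodType k)
    (f : M -> M') (g : N -> N') : tens M N -> tens M' N' :=
  tlift (fun m n => tpure (f m) (g n)).

Section Tmap.
Variables (k : comPzRingType) (M N M' N' : lmodType k).
Variables (f : M -> M') (g : N -> N').
Hypotheses (flin : linear f) (glin : linear g).

Lemma tmap_bilin : bilin (fun m n => tpure (f m) (g n)).
Proof.
have [pr pl] := tpure_bilin M' N'.
by split=> [m x n n'|n x m m'] /=; rewrite ?flin ?glin (pr, pl).
Qed.

Lemma tmapE m n : tmap f g (tpure m n) = tpure (f m) (g n).
Proof. exact: tliftE tmap_bilin m n. Qed.

Lemma tmap_linear : linear (tmap f g).
Proof. exact: tlift_linear tmap_bilin. Qed.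

End Tmap.

(** * Linear categories, functors and modules *)

Record lincat (k : comPzRingType) := Lincat {
  obj :> Type;
  lhom : obj -> obj -> lmodType k;
  lid : forall A, lhom A A;
  lcomp : forall A B C, lhom B C -> lhom A B -> lhom A C;
  lcomp_bilin : forall A B C, bilin (@lcomp A B C);
  lcompA : forall A B C D (h : lhom C D) (g : lhom B C) (f : lhom A B),
    lcomp h (lcomp g f) = lcomp (lcomp h g) f;
  lcomp1m : forall A B (f : lhom A B), lcomp (lid B) f = f;
  lcompm1 : forall A B (f : lhom A B), lcomp f (lid A) = f
}.
Arguments lhom {k a} : rename.
Arguments lid {k a} A : rename.
Arguments lcomp {k a A B C} : rename.

Record linfunctor (k : comPzRingType) (a c : lincat k) := Linfunctor {
  fobj :> a -> c;
  fmor : forall A B, lhom A B -> lhom (fobj A) (fobj B);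
  fmor_linear : forall A B, linear (@fmor A B);
  fmor1 : forall A, fmor (lid A) = lid (fobj A);
  fmorM : forall A B C (g : lhom B C) (f : lhom A B),
    fmor (lcomp g f) = lcomp (fmor g) (fmor f)
}.
Arguments fmor {k a c} phi {A B} : rename.

(* Right modules, i.e. objects of Mod(a): linear functors from the opposite of
   a to the k-modules; [ract F f x] is F(f)(x). *)
Record rmod (k : comPzRingType) (a : lincat k) := Rmod {
  rval :> a -> lmodType k;
  ract : forall A' A, lhom A' A -> rval A -> rval A';
  ract_bilin : forall A' A, bilin (@ract A' A);
  ract1 : forall A (x : rval A), ract (lid A) x = x;
  ractM : forall A B C (g : lhom B C) (f : lhom A B) (x : rval C),
    ract (lcomp g f) x = ract f (ract g x)
}.
Arguments ract {k a} F {A' A} : rename.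

Record rmod_hom (k : comPzRingType) (a : lincat k) (F G : rmod a) := RmodHom {
  rhom :> forall A, F A -> G A;
  rhom_linear : forall A, linear (@rhom A);
  rhom_nat : forall A' A (f : lhom A' A) (x : F A),
    rhom (ract F f x) = ract G f (rhom x)
}.
Arguments rhom {k a F G} u A : rename.

Lemma rmod_hom_ext (k : comPzRingType) (a : lincat k) (F G : rmod a)
  (u v : rmod_hom F G) : (forall A x, u A x = v A x) -> u = v.
Proof.
case: u v => [u ul un] [v vl vn] /= uv.
have {}uv : u = v by apply: functional_extensionality_dep => A; apply: funext.
by rewrite uv in ul un *; congr RmodHom; apply: Prop_irrelevance.
Qed.

Section Restriction.
Variables (k : comPzRingType) (a c : lincat k) (phi : linfunctor a c).
Variable F : rmod c.

Let act A' A (f : lhom A' A) (x : F (phi A)) : F (phi A') :=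
  ract F (fmor phi f) x.

Lemma rmod_restr_bilin A' A : bilin (@act A' A).
Proof.
have [Fr Fl] := ract_bilin F (phi A') (phi A).
split=> [f x u v|u x f g]; rewrite /act; first exact: Fr.
by rewrite fmor_linear; apply: Fl.
Qed.

Lemma rmod_restr1 A x : act (lid A) x = x.
Proof. by rewrite /act fmor1 ract1. Qed.

Lemma rmod_restrM A B C (g : lhom B C) (f : lhom A B) x :
  act (lcomp g f) x = act f (act g x).
Proof. by rewrite /act fmorM ractM. Qed.

Definition rmod_restr : rmod a :=
  Rmod rmod_restr_bilin rmod_restr1 rmod_restrM.

End Restriction.

(** * Sieves, cover systems and sheaves *)

Record sieve (k : comPzRingType) (a : lincat k) (A : a) := Sieve {
  smem :> forall A', set (lhom A' A);
  smem0 : forall A', @smem A' 0;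
  smem_lin : forall A' (x : k) (f g : lhom A' A),
    @smem A' f -> @smem A' g -> @smem A' (x *: f + g);
  smem_comp : forall A'' A' (f : lhom A' A) (g : lhom A'' A'),
    @smem A' f -> @smem A'' (lcomp f g)
}.
Arguments smem {k a A} R A' : rename.

Lemma sieve_ext (k : comPzRingType) (a : lincat k) (A : a) (R S : sieve A) :
  (forall A' (f : lhom A' A), R A' f <-> S A' f) -> R = S.
Proof.
case: R S => [R R0 Rl Rc] [S S0 Sl Sc] /= RS.
have {}RS : R = S.
  apply: functional_extensionality_dep => A'; apply: funext => f.
  exact: propext.
by rewrite RS in R0 Rl Rc *; congr Sieve; apply: Prop_irrelevance.
Qed.

Section SieveModule.
Variables (k : comPzRingType) (a : lincat k) (A : a) (R : sieve A).

Definition smem_pred (A' : a) : {pred lhom A' A} := fun f => `[< R A' f >].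
Arguments smem_pred : clear implicits.

Definition sieve_at (A' : a) := {f : lhom A' A | smem_pred A' f}.

Lemma smem_closed A' : GRing.subsemimod_closed (smem_pred A').
Proof.
have lin x (f g : lhom A' A) :
    f \in smem_pred A' -> g \in smem_pred A' -> x *: f + g \in smem_pred A'.
  by move=> /asboolP Rf /asboolP Rg; apply/asboolP/smem_lin.
have zero : 0 \in smem_pred A' by apply/asboolP/smem0.
split; first split=> // f g Rf Rg.
  by rewrite -[f]scale1r; apply: lin.
by move=> x f Rf; rewrite -[_ *: _]addr0; apply: lin.
Qed.

HB.instance Definition _ (A' : a) := SubChoice.on (sieve_at A').
HB.instance Definition _ (A' : a) :=
  GRing.SubChoice_isSubLmodule.Build k (lhom A' A) (smem_pred A')
    (sieve_at A') (smem_closed A').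

Definition sieve_val A' (f : sieve_at A') : lhom A' A := val f.

Lemma sieve_atP A' (f : sieve_at A') : R A' (sieve_val f).
Proof. exact/asboolP/(valP f). Qed.

Lemma smem_predP A' (f : lhom A' A) : R A' f -> smem_pred A' f.
Proof. by move=> Rf; apply/asboolP. Qed.

Lemma sieve_val_inj A' : injective (@sieve_val A').
Proof. exact: val_inj. Qed.

Lemma sieve_val_linear A' : linear (@sieve_val A').
Proof. exact: linearP. Qed.

Definition sact A'' A' (g : lhom A'' A') (f : sieve_at A') : sieve_at A'' :=
  exist _ (lcomp (sieve_val f) g) (smem_predP (smem_comp g (sieve_atP f))).

Lemma sact_bilin A'' A' : bilin (@sact A'' A').
Proof.
have [cr cl] := lcomp_bilin A'' A' A.
split=> [g x f f'|f x g g']; apply: sieve_val_inj; rewrite sieve_val_linear.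
  by rewrite -cl -sieve_val_linear.
exact: cr.
Qed.

Lemma sact1 A' (f : sieve_at A') : sact (lid A') f = f.
Proof. by apply: sieve_val_inj; apply: lcompm1. Qed.

Lemma sactM A1 A2 A3 (g : lhom A2 A3) (h : lhom A1 A2) (f : sieve_at A3) :
  sact (lcomp g h) f = sact h (sact g f).
Proof. by apply: sieve_val_inj; apply: lcompA. Qed.

Definition sieve_rmod : rmod a := Rmod sact_bilin sact1 sactM.

(* The composite F(A) ~ Hom(a(-, A), F) -> Hom(R, F) of the Yoneda isomorphism
   and the restriction along the inclusion of R. *)
Section SectionMap.
Variables (F : rmod a) (x : F A).

Let ev A' (f : sieve_rmod A') : F A' := ract F (sieve_val f) x.

Lemma sieve_restr_linear A' : linear (@ev A').
Proof.
have [_ Fl] := ract_bilin F A' A.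
by move=> y f g; rewrite /ev sieve_val_linear; apply: Fl.
Qed.

Lemma sieve_restr_nat A'' A' (g : lhom A'' A') (f : sieve_rmod A') :
  ev (ract sieve_rmod g f) = ract F g (ev f).
Proof. exact: ractM. Qed.

Definition sieve_restr : rmod_hom sieve_rmod F :=
  RmodHom sieve_restr_linear sieve_restr_nat.

End SectionMap.
End SieveModule.
Arguments smem_pred {k a A} R A'.
Arguments sieve_val {k a A R A'} f.
Arguments sact {k a A R A'' A'} g f.

Section SieveOps.
Variables (k : comPzRingType) (a : lincat k).

Definition max_sieve (A : a) : sieve A :=
  @Sieve k a A (fun A' => setT) (fun _ => I) (fun _ _ _ _ _ _ => I)
    (fun _ _ _ _ _ => I).

Variables (A A' : a) (f : lhom A' A) (R : sieve A).

Let pb A'' : set (lhom A'' A') := [set g | R A'' (lcomp f g)].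

Lemma pull_sieve0 A'' : pb (0 : lhom A'' A').
Proof.
have [_ _ _ _ /(_ 0 f 0)] := bilin_rules (lcomp_bilin A'' A' A).
by rewrite /pb /= !scale0r => ->; apply: smem0.
Qed.

Lemma pull_sieve_lin A'' (x : k) (g h : lhom A'' A') :
  pb g -> pb h -> pb (x *: g + h).
Proof.
have [cr _] := lcomp_bilin A'' A' A.
by move=> Rg Rh; rewrite /pb /= cr; apply: smem_lin.
Qed.

Lemma pull_sieve_comp A3 A'' (g : lhom A'' A') (h : lhom A3 A'') :
  pb g -> pb (lcomp g h).
Proof. by move=> Rg; rewrite /pb /= lcompA; apply: smem_comp. Qed.

Definition pull_sieve : sieve A' :=
  Sieve pull_sieve0 pull_sieve_lin pull_sieve_comp.

End SieveOps.

Definition cover_system (k : comPzRingType) (a : lincat k) :=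
  forall A : a, set (sieve A).

Section CoverSystems.
Variables (k : comPzRingType) (a : lincat k).

Definition localizing (T : cover_system a) : Prop :=
  (forall A, T A (max_sieve A)) /\
  (forall A A' (f : lhom A' A) (R : sieve A), T A R -> T A' (pull_sieve f R)).

Definition glueing (T : cover_system a) : Prop :=
  forall A (R S : sieve A), T A R ->
    (forall A' (f : lhom A' A), R A' f -> T A' (pull_sieve f S)) -> T A S.

Definition topology (T : cover_system a) : Prop := localizing T /\ glueing T.

Definition is_sheaf (T : cover_system a) (F : rmod a) : Prop :=
  forall A (R : sieve A), T A R ->
    bijective (@sieve_restr k a A R F : F A -> rmod_hom (sieve_rmod R) F).

End CoverSystems.

Definition continuous_functor (k : comPzRingType) (a c : lincat k)
    (Ta : cover_system a) (Tc : cover_system c) (phi : linfunctor a c) : Prop :=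
  forall F : rmod c, is_sheaf Tc F -> is_sheaf Ta (rmod_restr phi F).

(** * Tensor products of categories, functors and cover systems *)

Section TensorCat.
Variables (k : comPzRingType) (a b : lincat k).

Definition tcat_hom (X Y : a * b) : lmodType k :=
  tens (lhom X.1 Y.1) (lhom X.2 Y.2).

Definition tcat_idm (X : a * b) : tcat_hom X X := tpure (lid X.1) (lid X.2).

(* (g (x) g') o (f (x) f') = (g o f) (x) (g' o f'), see [tcat_compE]. *)
Definition tcat_comp (X Y Z : a * b) (u : tcat_hom Y Z) (v : tcat_hom X Y) :
    tcat_hom X Z :=
  tlift (fun g g' => tmap (lcomp g) (lcomp g') v) u.

Lemma tcat_comp_bilin_aux (X Y Z : a * b) (v : tcat_hom X Y) :
  bilin (fun (g : lhom Y.1 Z.1) (g' : lhom Y.2 Z.2) =>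
    tmap (lcomp g) (lcomp g') v : tcat_hom X Z).
Proof.
have [cr cl] := lcomp_bilin X.1 Y.1 Z.1; have [cr' cl'] := lcomp_bilin X.2 Y.2 Z.2.
have [pr pl] := tpure_bilin (lhom X.1 Z.1) (lhom X.2 Z.2).
have tl g g' := tmap_linear (cr g) (cr' g').
have D (g : lhom Y.1 Z.1) (g' : lhom Y.2 Z.2) (u w : tcat_hom X Y) :
    tmap (lcomp g) (lcomp g') (u + w) =
    tmap (lcomp g) (lcomp g') u + tmap (lcomp g) (lcomp g') w.
  by have := tl g g' 1 u w; rewrite !scale1r.
have Z0 (g : lhom Y.1 Z.1) (g' : lhom Y.2 Z.2) :
    tmap (lcomp g) (lcomp g') (0 : tcat_hom X Y) = 0.
  by have := tl g g' (-1) 0 0; rewrite scaleN1r oppr0 add0r scaleN1r addNr.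
split=> [g x h h'|g x h h'] /=; elim/tens_ind: v => [|m n t IHt].
- by rewrite !Z0 scaler0 addr0.
- rewrite !D IHt (tmapE (cr g) (cr' _)) !(tmapE (cr g) (cr' _)).
  by rewrite cl' pr scalerDr addrACA.
- by rewrite !Z0 scaler0 addr0.
- rewrite !D IHt !(tmapE (cr _) (cr' g)).
  by rewrite cl pl scalerDr addrACA.
Qed.

Lemma tcat_compE (X Y Z : a * b) (g : lhom Y.1 Z.1) (g' : lhom Y.2 Z.2)
    (f : lhom X.1 Y.1) (f' : lhom X.2 Y.2) :
  tcat_comp (tpure g g' : tcat_hom Y Z) (tpure f f' : tcat_hom X Y) =
  tpure (lcomp g f) (lcomp g' f').
Proof.
rewrite /tcat_comp (tliftE (tcat_comp_bilin_aux _ _)).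
by rewrite tmapE //; [have [] := lcomp_bilin X.1 Y.1 Z.1
                     |have [] := lcomp_bilin X.2 Y.2 Z.2].
Qed.

Lemma tcat_comp_bilin X Y Z : bilin (@tcat_comp X Y Z).
Proof.
have [cr cl] := lcomp_bilin X.1 Y.1 Z.1; have [cr' cl'] := lcomp_bilin X.2 Y.2 Z.2.
have lin v : linear (@tcat_comp X Y Z ^~ v).
  exact: tlift_linear (tcat_comp_bilin_aux Z v).
split=> // u x v w.
have D (u1 u2 : tcat_hom Y Z) (t : tcat_hom X Y) :
    tcat_comp (u1 + u2) t = tcat_comp u1 t + tcat_comp u2 t.
  by have := lin t 1 u1 u2; rewrite !scale1r.
have Z0 (t : tcat_hom X Y) : tcat_comp (0 : tcat_hom Y Z) t = 0.
  by have := lin t (-1) 0 0; rewrite scaleN1r oppr0 add0r scaleN1r addNr.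
elim/tens_ind: u => [|m n t IHt]; first by rewrite !Z0 scaler0 addr0.
rewrite !D IHt /tcat_comp !(tliftE (tcat_comp_bilin_aux _ _)).
by rewrite (tmap_linear (cr m) (cr' n)) scalerDr addrACA.
Qed.

Lemma tcat_compA (X Y Z W : a * b)
    (u : tcat_hom Z W) (v : tcat_hom Y Z) (w : tcat_hom X Y) :
  tcat_comp u (tcat_comp v w) = tcat_comp (tcat_comp u v) w.
Proof.
have [_ DlXYZ DrXYZ _ _] := bilin_rules (tcat_comp_bilin X Y Z).
have [_ DlXZW DrXZW _ _] := bilin_rules (tcat_comp_bilin X Z W).
have [_ DlYZW DrYZW _ _] := bilin_rules (tcat_comp_bilin Y Z W).
have [_ DlXYW DrXYW _ _] := bilin_rules (tcat_comp_bilin X Y W).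
have r0 X' Y' Z' t : tcat_comp (t : tcat_hom Y' Z') (0 : tcat_hom X' Y') = 0.
  have [_ _ _ _ /(_ 0 t 0)] := bilin_rules (tcat_comp_bilin X' Y' Z').
  by rewrite !scale0r.
have l0 X' Y' Z' t : tcat_comp (0 : tcat_hom Y' Z') (t : tcat_hom X' Y') = 0.
  by have [-> _ _ _ _] := bilin_rules (tcat_comp_bilin X' Y' Z').
elim/tens_ind: u => [|h h' u IHu]; first by rewrite !l0.
rewrite DlXZW DlYZW DlXYW IHu; congr (_ + _) => {u IHu}.
elim/tens_ind: v => [|g g' v IHv]; first by rewrite !(l0, r0).
rewrite DlXYZ DrYZW DlXYW DrXZW IHv; congr (_ + _) => {v IHv}.
elim/tens_ind: w => [|f f' w IHw]; first by rewrite !r0.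
rewrite DrXYZ DrXYW DrXZW IHw; congr (_ + _) => {w IHw}.
by rewrite !tcat_compE !lcompA.
Qed.

Lemma tcat_comp1m (X Y : a * b) (u : tcat_hom X Y) :
  tcat_comp (tcat_idm Y) u = u.
Proof.
have [_ _ Dr _ Zr] := bilin_rules (tcat_comp_bilin X Y Y).
elim/tens_ind: u => [|f f' u IHu].
  by have := Zr 0 (tcat_idm Y) 0; rewrite !scale0r.
by rewrite Dr IHu tcat_compE !lcomp1m.
Qed.

Lemma tcat_compm1 (X Y : a * b) (u : tcat_hom X Y) :
  tcat_comp u (tcat_idm X) = u.
Proof.
have [l0 Dl _ _ _] := bilin_rules (tcat_comp_bilin X X Y).
elim/tens_ind: u => [|f f' u IHu]; first exact: l0.
by rewrite Dl IHu tcat_compE !lcompm1.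
Qed.

Definition tcat : lincat k :=
  Lincat tcat_comp_bilin tcat_compA tcat_comp1m tcat_compm1.

End TensorCat.

Section TensorFunctor.
Variables (k : comPzRingType) (a b c d : lincat k).
Variables (phi : linfunctor a c) (psi : linfunctor b d).

Definition tfun_obj (X : tcat a b) : tcat c d := (phi X.1, psi X.2).

Definition tfun_mor (X Y : tcat a b) (u : lhom X Y) :
    lhom (tfun_obj X) (tfun_obj Y) :=
  tmap (fmor phi (A:=X.1) (B:=Y.1)) (fmor psi (A:=X.2) (B:=Y.2)) u.

Lemma tfun_mor_linear X Y : linear (@tfun_mor X Y).
Proof. by apply: tmap_linear; apply: fmor_linear. Qed.

Lemma tfun_morE (X Y : tcat a b) (f : lhom X.1 Y.1) (g : lhom X.2 Y.2) :
  tfun_mor (tpure f g : lhom X Y) = tpure (fmor phi f) (fmor psi g).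
Proof. by rewrite /tfun_mor tmapE //; apply: fmor_linear. Qed.

Lemma tfun_mor1 (X : tcat a b) : tfun_mor (lid X) = lid (tfun_obj X).
Proof. by rewrite [LHS]tfun_morE !fmor1. Qed.

Lemma tfun_morM (X Y Z : tcat a b) (u : lhom Y Z) (v : lhom X Y) :
  tfun_mor (lcomp u v) = lcomp (tfun_mor u) (tfun_mor v).
Proof.
have D X' Y' (s t : lhom X' Y') : tfun_mor (s + t) = tfun_mor s + tfun_mor t.
  by have := tfun_mor_linear (X:=X') (Y:=Y') 1 s t; rewrite !scale1r.
have Z0 X' Y' : tfun_mor (0 : lhom X' Y') = 0.
  have := tfun_mor_linear (X:=X') (Y:=Y') (-1) 0 0.
  by rewrite scaleN1r oppr0 add0r scaleN1r addNr.
have [l0 Dl Dr _ Zr] := bilin_rules (lcomp_bilin X Y Z).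
have [l0' Dl' Dr' _ Zr'] :=
  bilin_rules (lcomp_bilin (tfun_obj X) (tfun_obj Y) (tfun_obj Z)).
have r0 t : lcomp t (0 : lhom X Y) = 0 :> lhom X Z.
  by have := Zr 0 t 0; rewrite !scale0r.
have r0' t : lcomp t (0 : lhom (tfun_obj X) (tfun_obj Y)) = 0
    :> lhom (tfun_obj X) (tfun_obj Z).
  by have := Zr' 0 t 0; rewrite !scale0r.
elim/tens_ind: u => [|g g' u IHu]; first by rewrite l0 !Z0 l0'.
rewrite Dl !D Dl' IHu; congr (_ + _) => {u IHu}.
elim/tens_ind: v => [|f f' v IHv]; first by rewrite r0 !Z0 r0'.
rewrite Dr !D Dr' IHv; congr (_ + _) => {v IHv}.
rewrite [in LHS]/= tcat_compE !tfun_morE [in RHS]/=.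
by rewrite [RHS]tcat_compE !fmorM.
Qed.

Definition tfun : linfunctor (tcat a b) (tcat c d) :=
  Linfunctor tfun_mor_linear tfun_mor1 tfun_morM.

End TensorFunctor.

Section BoxSieve.
Variables (k : comPzRingType) (a b : lincat k) (A : a) (B : b).
Variables (R : sieve A) (S : sieve B).

Let AB : tcat a b := (A, B).

(* The map R(A') (x) S(B') -> a(A', A) (x) b(B', B), not injective in general. *)
Definition box_incl (X : tcat a b) :
    tens (sieve_rmod R X.1) (sieve_rmod S X.2) -> lhom X AB :=
  tmap (@sieve_val k a A R X.1) (@sieve_val k b B S X.2).

Lemma box_incl_linear X : linear (@box_incl X).
Proof. by apply: tmap_linear; apply: sieve_val_linear. Qed.

Let bmem (X : tcat a b) : set (lhom X AB) := range (@box_incl X).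

Lemma box_sieve0 X : bmem (0 : lhom X AB).
Proof.
exists 0 => //; have := box_incl_linear (X:=X) (-1) 0 0.
by rewrite scaleN1r oppr0 add0r scaleN1r addNr.
Qed.

Lemma box_sieve_lin X (x : k) (u v : lhom X AB) :
  bmem u -> bmem v -> bmem (x *: u + v).
Proof.
by move=> [s _ <-] [t _ <-]; exists (x *: s + t); rewrite ?box_incl_linear.
Qed.

Lemma box_sieve_comp Y X (u : lhom X AB) (w : lhom Y X) :
  bmem u -> bmem (lcomp u w).
Proof.
have memD Z (s t : lhom Z AB) : bmem s -> bmem t -> bmem (s + t).
  by move=> ms mt; rewrite -[s]scale1r; apply: box_sieve_lin.
have D (s t : tens (sieve_rmod R X.1) (sieve_rmod S X.2)) :
    box_incl (X:=X) (s + t) = box_incl (X:=X) s + box_incl (X:=X) t.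
  by have := box_incl_linear (X:=X) 1 s t; rewrite !scale1r.
have Z0 : box_incl (X:=X) 0 = 0.
  have := box_incl_linear (X:=X) (-1) 0 0.
  by rewrite scaleN1r oppr0 add0r scaleN1r addNr.
have [l0 Dl Dr _ Zr] := bilin_rules (lcomp_bilin Y X AB).
have r0 t : lcomp t (0 : lhom Y X) = 0 :> lhom Y AB.
  by have := Zr 0 t 0; rewrite !scale0r.
move=> [t _ <-]; elim/tens_ind: t => [|f g t IHt].
  by rewrite Z0 l0; apply: box_sieve0.
rewrite D Dl; apply: (memD) => // {t IHt}.
elim/tens_ind: w => [|f' g' w IHw]; first by rewrite r0; apply: box_sieve0.
rewrite Dr; apply: (memD) => // {w IHw}.
exists (tpure (sact f' f) (sact g' g)) => //.
rewrite /box_incl !tmapE; do ?[exact: sieve_val_linear].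
by rewrite [RHS]tcat_compE.
Qed.

Definition box_sieve : sieve AB :=
  Sieve box_sieve0 box_sieve_lin box_sieve_comp.

End BoxSieve.

Section BoxCover.
Variables (k : comPzRingType) (a b : lincat k).
Variables (Ta : cover_system a) (Tb : cover_system b).

Definition contains_boxes (T : cover_system (tcat a b)) : Prop :=
  (forall (A : a) (B : b) (R : sieve A), @Ta A R ->
     T (A, B) (box_sieve R (max_sieve B))) /\
  (forall (A : a) (B : b) (S : sieve B), @Tb B S ->
     T (A, B) (box_sieve (max_sieve A) S)).

Definition box_cover : cover_system (tcat a b) := fun X =>
  [set R | forall T : cover_system (tcat a b),
     topology T -> contains_boxes T -> T X R].
Arguments box_cover : clear implicits.

Lemma box_cover_topology : topology box_cover.
Proof.
split; first split.
- by move=> X T [[Ti _] _] _; apply: Ti.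
- move=> X Y f R TR T TT TB; have [[_ Tp] _] := TT.
  by apply: Tp; apply: TR.
- move=> X R S TR TS T TT TB; have [_ Tg] := TT.
  by apply: (Tg X R) => [|Y f Rf]; [apply: TR|apply: TS].
Qed.

Lemma box_cover_contains : contains_boxes box_cover.
Proof.
split=> A B R TR T _ [T1 T2]; [exact: T1|exact: T2].
Qed.

Lemma box_cover_min (T : cover_system (tcat a b)) :
  topology T -> contains_boxes T -> forall X, box_cover X `<=` T X.
Proof. by move=> TT TB X R; apply. Qed.

End BoxCover.
Arguments box_cover {k a b} Ta Tb X : rename.

(* Main.v *)
Require Import Defs.
From HB Require Import structures.
From mathcomp Require Import all_boot all_algebra.
From mathcomp Require Import boolp classical_sets.

Set Implicit Arguments.
Unset Strict Implicit.
Unset Printing Implicit Defensive.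

Import GRing.Theory.
Local Open Scope ring_scope.

(** The theorem reduces to a description of the sheaves on a tensor product
    ([box_sheafP]): for localizing cover systems, a module [F] on a (x) b is a
    sheaf for the box topology if and only if all its slices [F(-, B)] and
    [F(A, -)] are sheaves.  The slices of the pullback of [F] along
    phi (x) psi are the pullbacks along [phi] and [psi] of slices of [F], so
    that continuity passes from [phi] and [psi] to their tensor product.

    From slices to the tensor product ([eff_top_of_slices]).  The sieves that
    are effective for [F] together with all their pullbacks form a topology
    ([eff_top_topology]), so it is enough to show that the box sieves are among
    them.  A morphism of a (x) b is a finite sum of tensors f_i (x) g_i, and the
    pullback along it of the box sieve of [R] contains all h (x) 1 with [h] in
    the intersection of the f_i^-1 R.  This intersection is a cover in the
    topology generated by the given covers, for which the slices are still
    sheaves.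

    From the tensor product to slices ([slice_sheaf]).  A compatible family on
    [R] with values in [F(-, B)] extends to R (x) b(-, B), but the box sieve is
    only the image of this module in a (x) b, and the family has to vanish on
    the kernel.  The kernel comes from Tor_1 of the torsion module a(-, A)/R,
    hence is locally zero: a derivation of sum r_i (x) g_i = 0 over a(A', A)
    mentions only finitely many elements h_j of a(A', A), and after composition
    with any [f] in the intersection of the h_j^-1 R it becomes a derivation
    over [R] ([tens_rel_locality]).  Since the slices of [F] are separated for
    this intersection, the extended family vanishes on the kernel ([ext0]).

    The two factors play symmetric roles.  The arguments are carried out for a
    category [e] presented as a tensor product of [a] and [b] ([tensor_of]);
    such a presentation can be swapped, which gives the second slice. *)

(** * Linear maps, modules and sieves *)

Section LinearMaps.
Variables (k : comPzRingType) (U V : lmodType k) (f : U -> V).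
Hypothesis f_lin : linear f.

Lemma lin0 : f 0 = 0.
Proof. by have := f_lin (-1) 0 0; rewrite scaleN1r oppr0 add0r scaleN1r addNr. Qed.

Lemma linB u v : f (u - v) = f u - f v.
Proof. by have := f_lin (-1) v u; rewrite !scaleN1r !(addrC (- _)). Qed.

Lemma lin_sum (I : Type) (s : seq I) (F : I -> U) :
  f (\sum_(i <- s) F i) = \sum_(i <- s) f (F i).
Proof.
elim: s => [|i s IHs]; first by rewrite !big_nil lin0.
by rewrite !big_cons -IHs; have := f_lin 1 (F i) (\sum_(j <- s) F j); rewrite !scale1r.
Qed.

End LinearMaps.

Section BilinearActions.
Variables (k : comPzRingType) (a : lincat k) (M : rmod a).

Lemma ract_linr A' A (f : lhom A' A) : linear (ract M f).
Proof. by have [] := ract_bilin M A' A. Qed.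

Lemma ract_linl A' A (x : M A) : linear (fun f : lhom A' A => ract M f x).
Proof. by have [] := ract_bilin M A' A. Qed.

Lemma lcomp_linr (A B C : a) (g : lhom B C) : linear (@lcomp k a A B C g).
Proof. by have [] := lcomp_bilin A B C. Qed.

Lemma lcomp_linl (A B C : a) (f : lhom A B) :
  linear (fun g : lhom B C => lcomp g f).
Proof. by have [] := lcomp_bilin A B C. Qed.

End BilinearActions.

Section Sieves.
Variables (k : comPzRingType) (a : lincat k).

Lemma smem_sum (A A' : a) (R : sieve A) (I : eqType) (s : seq I)
    (F : I -> lhom A' A) :
  (forall i, i \in s -> R A' (F i)) -> R A' (\sum_(i <- s) F i).
Proof.
move=> RF; rewrite big_seq; apply: (big_ind (R A')); first exact: smem0.
- by move=> f g Rf Rg; rewrite -[f]scale1r; apply: smem_lin.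
- exact: RF.
Qed.

Lemma pull_sieve1 (A : a) (R : sieve A) : pull_sieve (lid A) R = R.
Proof. by apply: sieve_ext => A' f; rewrite /pull_sieve /= lcomp1m. Qed.

Lemma pull_sieveM (A A' A'' : a) (f : lhom A' A) (g : lhom A'' A')
    (R : sieve A) :
  pull_sieve g (pull_sieve f R) = pull_sieve (lcomp f g) R.
Proof. by apply: sieve_ext => X h; rewrite /pull_sieve /= lcompA. Qed.

(** Finite intersections of pullbacks h^-1 R: the list [hs] will collect the
    finitely many first components of a morphism of a tensor product. *)
Section MultiPull.
Variables (A A' : a) (hs : seq (lhom A' A)) (R : sieve A).

Let mem X (f : lhom X A') := forall h, h \in hs -> R X (lcomp h f).

Lemma multi_pull0 X : mem (0 : lhom X A').
Proof. by move=> h _; rewrite (lin0 (lcomp_linr h)); apply: smem0. Qed.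

Lemma multi_pull_lin X (x : k) (f g : lhom X A') :
  mem f -> mem g -> mem (x *: f + g).
Proof.
by move=> Rf Rg h hh; rewrite lcomp_linr; apply: smem_lin; [apply: Rf|apply: Rg].
Qed.

Lemma multi_pull_comp Y X (f : lhom X A') (g : lhom Y X) :
  mem f -> mem (lcomp f g).
Proof. by move=> Rf h hh; rewrite lcompA; apply/smem_comp/Rf. Qed.

Definition multi_pull : sieve A' :=
  Sieve multi_pull0 multi_pull_lin multi_pull_comp.

End MultiPull.

(** Covers of a topology are stable under finite intersections: on any element
    of h^-1 R, the intersection over [h :: hs] and the one over [hs] have the
    same pullback, so the glueing axiom applies. *)
Lemma multi_pull_cover (T : cover_system a) (A A' : a) (hs : seq (lhom A' A))
    (R : sieve A) : topology T -> T A R -> T A' (multi_pull hs R).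
Proof.
move=> [[T1 Tp] Tg] TR; elim: hs => [|h hs IHs].
  by rewrite (_ : multi_pull _ _ = max_sieve A') //; apply: sieve_ext.
apply: (Tg _ (pull_sieve h R)); first exact: Tp.
move=> X f Rf.
rewrite (_ : pull_sieve f _ = pull_sieve f (multi_pull hs R)); first exact: Tp IHs.
apply: sieve_ext => Y g /=; split=> Sg h' hh'.
  by apply: Sg; rewrite inE hh' orbT.
move: hh'; rewrite inE => /predU1P[->|/Sg//].
by rewrite lcompA; apply: smem_comp.
Qed.

End Sieves.

(** * The finest topology for which a module is a sheaf *)

Section Amalgamation.
Variables (k : comPzRingType) (a : lincat k) (M : rmod a).

Definition separates (A : a) (R : sieve A) : Prop :=
  forall x : M A, (forall A' (f : lhom A' A), R A' f -> ract M f x = 0) -> x = 0.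

(** A morphism from [R] to [M], encoded by a family of functions on all
    morphisms to [A] that carries no information outside [R]; this avoids
    working with elements of the subtype [sieve_at R]. *)
Definition compatible (A : a) (R : sieve A) (e : forall A', lhom A' A -> M A') :=
  (forall A' (x : k) (f g : lhom A' A), R A' f -> R A' g ->
     e A' (x *: f + g) = x *: e A' f + e A' g) /\
  (forall A'' A' (f : lhom A' A) (g : lhom A'' A'), R A' f ->
     e A'' (lcomp f g) = ract M g (e A' f)).

Definition amalgamates (A : a) (R : sieve A) : Prop :=
  forall e, compatible R e ->
    exists x : M A, forall A' (f : lhom A' A), R A' f -> e A' f = ract M f x.

Lemma separates_eq (A : a) (R : sieve A) (x y : M A) : separates R ->
  (forall A' (f : lhom A' A), R A' f -> ract M f x = ract M f y) -> x = y.
Proof.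
move=> sR xy; apply/subr0_eq/sR => A' f Rf.
by rewrite (linB (ract_linr f)) xy ?subrr.
Qed.

Lemma sieve_restr_bijP (A : a) (R : sieve A) :
  bijective (@sieve_restr k a A R M : M A -> rmod_hom (sieve_rmod R) M) <->
  separates R /\ amalgamates R.
Proof.
split=> [[g rK gK]|[sR aR]].
  split=> [x x0|e [el en]].
    apply: (can_inj rK); apply: rmod_hom_ext => A' f /=.
    by rewrite (lin0 (ract_linr _)) x0 //; apply: sieve_atP.
  pose u A' (f : sieve_rmod R A') := e A' (sieve_val f).
  have ul A' : linear (@u A').
    by move=> x f h; rewrite /u sieve_val_linear el //; apply: sieve_atP.
  have un A'' A' (h : lhom A'' A') (f : sieve_rmod R A') :
      u A'' (ract (sieve_rmod R) h f) = ract M h (u A' f).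
    by rewrite /u en //; apply: sieve_atP.
  pose hu := RmodHom ul un.
  exists (g hu) => A' f Rf.
  pose f' : sieve_rmod R A' := exist _ f (smem_predP Rf).
  by have := congr1 (fun v : rmod_hom _ _ => v A' f') (gK hu).
have inj : injective (@sieve_restr k a A R M).
  move=> x y xy; apply: (separates_eq sR) => A' f Rf.
  pose f' : sieve_rmod R A' := exist _ f (smem_predP Rf).
  by have := congr1 (fun v : rmod_hom _ _ => v A' f') xy.
have surj (u : rmod_hom (sieve_rmod R) M) : exists x, sieve_restr R x = u.
  pose e A' (f : lhom A' A) : M A' :=
    if pselect (R A' f) is left Rf then u A' (exist _ f (smem_predP Rf)) else 0.
  have eE A' (f : sieve_rmod R A') : e A' (sieve_val f) = u A' f.
    rewrite /e; case: pselect => [Rf|[]]; last exact: sieve_atP.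
    by congr (u _ _); apply: sieve_val_inj.
  have [|x xP] := aR e.
    split=> [A' x f g Rf Rg|A'' A' f g Rf].
      pose f' : sieve_rmod R A' := exist _ f (smem_predP Rf).
      pose g' : sieve_rmod R A' := exist _ g (smem_predP Rg).
      rewrite (eE _ f') (eE _ g') -rhom_linear -eE.
      by rewrite sieve_val_linear.
    pose f' : sieve_rmod R A' := exist _ f (smem_predP Rf).
    by rewrite (eE _ f') -rhom_nat -eE.
  exists x; apply: rmod_hom_ext => A' f /=.
  by rewrite -xP ?eE //; apply: sieve_atP.
exists (fun u => projT1 (cid (surj u))) => [x|u].
  by apply: inj; case: cid.
by case: cid.
Qed.

(** Universally separating and universally effective sieves.  The pullbacks
    are needed to make these collections stable under base change. *)
Definition sep_top : cover_system a := fun A R =>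
  forall A' (u : lhom A' A), separates (pull_sieve u R).

Definition eff_top : cover_system a := fun A R =>
  sep_top R /\ forall A' (u : lhom A' A), amalgamates (pull_sieve u R).

Lemma sep_top_topology : topology sep_top.
Proof.
split; first split.
- move=> A A' u x x0.
  by rewrite -[x](ract1 x) x0.
- by move=> A A' f R sR A'' u; rewrite pull_sieveM; apply: sR.
move=> A R S sR sS A' u x x0.
apply: (sR _ u) => A'' f Rf.
apply: (sS _ _ Rf _ (lid A'')) => X g; rewrite pull_sieve1 => Sg.
by rewrite -ractM x0 //= lcompA.
Qed.

Lemma sep_top_sep (A : a) (R : sieve A) : sep_top R -> separates R.
Proof. by move=> sR; rewrite -(pull_sieve1 R). Qed.

Lemma eff_top_amalg (A : a) (R : sieve A) : eff_top R -> amalgamates R.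
Proof. by move=> [_ aR]; rewrite -(pull_sieve1 R). Qed.

(** A compatible family [e] on [S] is first amalgamated over each f^-1 S, for
    [f] in [R]; the resulting elements form a compatible family on [R], which
    is amalgamated in turn. *)
Lemma eff_top_glueing_amalg (A : a) (R S : sieve A) : eff_top R ->
  (forall A' (f : lhom A' A), R A' f -> eff_top (pull_sieve f S)) ->
  amalgamates S.
Proof.
have [[_ sp] _] := sep_top_topology.
move=> ER ES e [el en].
pose t_spec A' (f : lhom A' A) (y : M A') :=
  forall X (g : lhom X A'), S X (lcomp f g) -> e X (lcomp f g) = ract M g y.
have tP A' (f : lhom A' A) : exists y : M A', R A' f -> t_spec A' f y.
  have [Rf|nRf] := pselect (R A' f); last by exists 0.
  have [|y yP] := eff_top_amalg (ES _ _ Rf) (e := fun X g => e X (lcomp f g)).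
    split=> [X x g h Sg Sh|Y X g h Sg]; first by rewrite lcomp_linr el.
    by rewrite lcompA en.
  by exists y.
pose t A' f : M A' := projT1 (cid (tP A' f)).
have tE A' f : R A' f -> t_spec A' f (t A' f).
  by rewrite /t; case: cid.
have t_uniq A' f y : R A' f -> t_spec A' f y -> t A' f = y.
  move=> Rf yP; have [sS _] := ES _ _ Rf.
  by apply: (separates_eq (sep_top_sep sS)) => X g Sg; rewrite -yP // -tE.
have [|x xP] := eff_top_amalg ER (e := t).
  split=> [A' x f g Rf Rg|A'' A' f g Rf].
    (* Separatedness is used twice, for f^-1 S and then for (g h)^-1 S, to
       reach morphisms on which both values of [t] are described by [e]. *)
    have [sSf _] := ES _ _ Rf; have [sSg _] := ES _ _ Rg.
    apply: (separates_eq (sep_top_sep sSf)) => X h Sfh.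
    have [|sSgh _] := ES _ (lcomp g h); first exact: smem_comp.
    apply: (separates_eq (sep_top_sep sSgh)) => Y j Sghj.
    have Sf : S Y (lcomp f (lcomp h j)) by rewrite lcompA; apply: smem_comp.
    have Sg : S Y (lcomp g (lcomp h j)) by rewrite lcompA.
    have Sfg : S Y (lcomp (x *: f + g) (lcomp h j)).
      by rewrite lcomp_linl; apply: smem_lin.
    rewrite -!ractM ract_linr -!tE //; last exact: smem_lin.
    by rewrite lcomp_linl el.
  apply: t_uniq => [|X h Sh]; first exact: smem_comp.
  by rewrite -ractM -lcompA -tE // lcompA.
exists x => A' s Ss.
have [sR _] := ER.
have sRs := sp _ _ s _ sR.
apply: (separates_eq (sep_top_sep sRs)) => X g Rsg.
rewrite -en // -ractM -xP //.
have := tE _ _ Rsg X (lid X); rewrite lcompm1 ract1; apply.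
exact: smem_comp.
Qed.

Lemma eff_top_topology : topology eff_top.
Proof.
have [[s1 sp] sg] := sep_top_topology.
have ep A A' (f : lhom A' A) (R : sieve A) : eff_top R -> eff_top (pull_sieve f R).
  move=> [sR aR]; split; first exact: sp.
  by move=> A'' u; rewrite pull_sieveM; apply: aR.
split; first split=> //.
  move=> A; split=> [|A' u e [_ en]]; first exact: s1.
  by exists (e _ (lid A')) => X f _; rewrite -en // lcomp1m.
move=> A R S ER ES; split.
  by apply: (sg _ R) => [|A' f /ES[]]; first by have [] := ER.
move=> A' u; apply: (@eff_top_glueing_amalg _ (pull_sieve u R)); first exact: ep.
by move=> A'' f Rf; rewrite pull_sieveM; apply: ES.
Qed.

(** The pullback axiom makes every cover universally effective for a sheaf, so
    that being a sheaf is an inclusion of [T] in the topology [eff_top]. *)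
Lemma localizing_sheafP (T : cover_system a) : localizing T ->
  is_sheaf T M <-> forall A (R : sieve A), T A R -> eff_top R.
Proof.
move=> [_ Tp]; split=> [sM A R TR|TE A R /TE[sR aR]].
  have H A' u := sM _ _ (Tp A A' u R TR).
  by split=> A' u; have /sieve_restr_bijP[] := H A' u.
apply/sieve_restr_bijP; split; first exact: sep_top_sep.
exact: eff_top_amalg.
Qed.

End Amalgamation.

(** * Relations in a tensor product *)

(** A derivation in the tensor product involves only finitely many elements
    [hs] of [M].  If these lie in a submodule [Q], the derivation takes place
    in Q (x) N, and a map [b] that is bilinear on [Q] alone respects it.  The
    list is chosen before [Q] and [b], so that it can be used for a whole family
    of submodules. *)
Lemma tens_rel_locality (k : comPzRingType) (M N : lmodType k)
    (s t : seq (M * N)) : tens_rel s t ->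
  exists hs : seq M, forall (P : lmodType k) (Q : M -> Prop) (b : M -> N -> P),
    Q 0 ->
    (forall x m m', Q m -> Q m' -> Q (x *: m + m')) ->
    (forall x m m' n, Q m -> Q m' -> b (x *: m + m') n = x *: b m n + b m' n) ->
    (forall m, Q m -> linear (b m)) ->
    (forall h, h \in hs -> Q h) ->
  \sum_(p <- s) b p.1 p.2 = \sum_(p <- t) b p.1 p.2.
Proof.
elim=> {s t}.
- by move=> s; exists [::].
- by move=> s t _ [hs H]; exists hs => P Q b *; rewrite (H P Q b).
- move=> t s u _ [hs H] _ [hs' H']; exists (hs ++ hs') => P Q b Q0 Ql bl br Qh.
  by rewrite (H P Q b) ?(H' P Q b) // => h hh; apply: Qh; rewrite mem_cat hh ?orbT.
- move=> s s' t t' _ [hs H] _ [hs' H']; exists (hs ++ hs') => P Q b Q0 Ql bl br Qh.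
  rewrite !big_cat /= (H P Q b) ?(H' P Q b) // => h hh.
    by apply: Qh; rewrite mem_cat hh ?orbT.
  by apply: Qh; rewrite mem_cat hh ?orbT.
- by move=> s t; exists [::] => P Q b *; rewrite !big_cat /= addrC.
- move=> n; exists [::] => P Q b Q0 Ql bl br _; rewrite big_seq1 big_nil /=.
  by have := bl (-1) 0 0 n Q0 Q0; rewrite scaleN1r oppr0 add0r scaleN1r addNr.
- move=> m m' n; exists [:: m; m'] => P Q b Q0 Ql bl br Qh.
  rewrite !big_cons !big_nil /= !addr0.
  have Qm : Q m by apply: Qh; rewrite inE eqxx.
  have Qm' : Q m' by apply: Qh; rewrite !inE eqxx orbT.
  by have := bl 1 m m' n Qm Qm'; rewrite !scale1r.
- move=> m n n'; exists [:: m] => P Q b Q0 Ql bl br Qh.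
  rewrite !big_cons !big_nil /= !addr0.
  have Qm : Q m by apply: Qh; rewrite inE eqxx.
  by have := br m Qm 1 n n'; rewrite !scale1r.
- move=> x m n; exists [:: m] => P Q b Q0 Ql bl br Qh.
  rewrite !big_seq1 /=.
  have Qm : Q m by apply: Qh; rewrite inE eqxx.
  have b0 : b 0 n = 0.
    by have := bl (-1) 0 0 n Q0 Q0; rewrite scaleN1r oppr0 add0r scaleN1r addNr.
  have := br m Qm x n 0; rewrite (lin0 (br m Qm)) !addr0 => ->.
  by have := bl x m 0 n Qm Q0; rewrite b0 !addr0.
Qed.

Definition swap_seq (M N : Type) (s : seq (M * N)) : seq (N * M) :=
  [seq (p.2, p.1) | p <- s].

Lemma tens_rel_swap (k : comPzRingType) (M N : lmodType k) (s t : seq (M * N)) :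
  tens_rel s t -> tens_rel (swap_seq s) (swap_seq t).
Proof.
elim=> {s t}; rewrite /swap_seq.
- by move=> s; apply: tens_refl.
- by move=> s t _; apply: tens_sym.
- by move=> t s u _ st _; apply: tens_trans.
- by move=> s s' t t' _ ss _ tt; rewrite !map_cat; apply: tens_cat.
- by move=> s t; rewrite !map_cat; apply: tens_catC.
- (* The pair (n, 0) is trivial because 0 = 0 *: 0 can be moved to [n]. *)
  move=> n /=; rewrite -(scale0r (0 : M)).
  apply: tens_trans (tens_sym (tensZ _ _ _)) _.
  by rewrite scale0r; apply: tens0l.
- by move=> m m' n; apply: tensDr.
- by move=> m n n'; apply: tensDl.
- by move=> x m n /=; apply: tens_sym; apply: tensZ.
Qed.

Lemma sum_tpure (k : comPzRingType) (M N : lmodType k) (s : seq (M * N)) :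
  \sum_(p <- s) tpure p.1 p.2 = tens_cls s.
Proof.
elim: s => [|[m n] s IHs]; first by rewrite big_nil.
by rewrite big_cons IHs [LHS]tens_add_cls.
Qed.

(** * Presentations of a category as a tensor product *)

(** What the proofs use of a (x) b.  Unlike a category of the form [tcat a b],
    such a structure on [e] is symmetric in [a] and [b].  Since [e] is not
    literally a category of pairs, [tpair_inj] is what recovers the components
    of an object. *)
Record tensor_of (k : comPzRingType) (a b e : lincat k) := TensorOf {
  tpair : a -> b -> e;
  tmor : forall A' A B' B, lhom A' A -> lhom B' B ->
    lhom (tpair A' B') (tpair A B);
  tpair_inj : forall A B A' B',
    tpair A B = tpair A' B' -> A = A' /\ B = B';
  tpair_surj : forall X, exists A B, X = tpair A B;
  tmor_bilin : forall A' A B' B, bilin (@tmor A' A B' B);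
  tmor1 : forall A B, tmor (lid A) (lid B) = lid (tpair A B);
  tmorM : forall A'' A' A B'' B' B (f : lhom A' A) (f' : lhom A'' A')
    (g : lhom B' B) (g' : lhom B'' B'),
    tmor (lcomp f f') (lcomp g g') = lcomp (tmor f g) (tmor f' g');
  tmor_span : forall A' A B' B (u : lhom (tpair A' B') (tpair A B)),
    exists s : seq (lhom A' A * lhom B' B), u = \sum_(p <- s) tmor p.1 p.2;
  tmor_rel : forall A' A B' B (s : seq (lhom A' A * lhom B' B)),
    \sum_(p <- s) tmor p.1 p.2 = 0 -> tens_rel s [::]
}.
Arguments tmor {k a b e} t {A' A B' B} : rename.

Section TensorOfTcat.
Variables (k : comPzRingType) (a b : lincat k).

Let pair (A : a) (B : b) : tcat a b := (A, B).

Let pure A' A B' B (f : lhom A' A) (g : lhom B' B) :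
  lhom (pair A' B') (pair A B) := tpure f g.

Lemma tcat_pair_inj A B A' B' : pair A B = pair A' B' -> A = A' /\ B = B'.
Proof. by case. Qed.

Lemma tcat_pair_surj X : exists A B, X = pair A B.
Proof. by case: X => A B; exists A, B. Qed.

Lemma tcat_pure_bilin A' A B' B : bilin (@pure A' A B' B).
Proof. exact: tpure_bilin. Qed.

Lemma tcat_pure1 A B : pure (lid A) (lid B) = lid (pair A B).
Proof. by []. Qed.

Lemma tcat_pureM A'' A' A B'' B' B (f : lhom A' A) (f' : lhom A'' A')
    (g : lhom B' B) (g' : lhom B'' B') :
  pure (lcomp f f') (lcomp g g') = lcomp (pure f g) (pure f' g').
Proof. by rewrite [RHS]tcat_compE. Qed.

Lemma tcat_pure_span A' A B' B (u : lhom (pair A' B') (pair A B)) :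
  exists s : seq (lhom A' A * lhom B' B), u = \sum_(p <- s) pure p.1 p.2.
Proof. by exists (tens_rep u); rewrite [RHS]sum_tpure tens_repK. Qed.

Lemma tcat_pure_rel A' A B' B (s : seq (lhom A' A * lhom B' B)) :
  \sum_(p <- s) pure p.1 p.2 = 0 -> tens_rel s [::].
Proof. by move=> s0; apply/tens_clsP; rewrite -sum_tpure [LHS]s0. Qed.

Definition tensor_of_tcat : tensor_of a b (tcat a b) :=
  TensorOf tcat_pair_inj tcat_pair_surj tcat_pure_bilin tcat_pure1 tcat_pureM
    tcat_pure_span tcat_pure_rel.

End TensorOfTcat.

Section TensorOfSwap.
Variables (k : comPzRingType) (a b e : lincat k) (t : tensor_of a b e).

Let pair B A := tpair t A B.
Let mor B' B A' A (g : lhom B' B) (f : lhom A' A) :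
  lhom (pair B' A') (pair B A) := tmor t f g.

Lemma sum_swap_seq B' B A' A (s : seq (lhom A' A * lhom B' B)) :
  \sum_(p <- swap_seq s) mor p.1 p.2 = \sum_(p <- s) tmor t p.1 p.2.
Proof. by rewrite big_map. Qed.

Lemma swap_pair_inj B A B' A' : pair B A = pair B' A' -> B = B' /\ A = A'.
Proof. by move=> /tpair_inj[-> ->]. Qed.

Lemma swap_pair_surj X : exists B A, X = pair B A.
Proof. by have [A [B ->]] := tpair_surj t X; exists B, A. Qed.

Lemma swap_mor_bilin B' B A' A : bilin (@mor B' B A' A).
Proof. by have [tr tl] := tmor_bilin t A' A B' B; split. Qed.

Lemma swap_mor_span B' B A' A (u : lhom (pair B' A') (pair B A)) :
  exists s : seq (lhom B' B * lhom A' A), u = \sum_(p <- s) mor p.1 p.2.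
Proof.
by have [s ->] := tmor_span (t := t) u; exists (swap_seq s); rewrite sum_swap_seq.
Qed.

Lemma swap_mor_rel B' B A' A (s : seq (lhom B' B * lhom A' A)) :
  \sum_(p <- s) mor p.1 p.2 = 0 -> tens_rel s [::].
Proof.
have -> : s = swap_seq (swap_seq s).
  by rewrite /swap_seq -map_comp map_id_in // => -[].
by rewrite sum_swap_seq => /tmor_rel/tens_rel_swap.
Qed.

Definition tensor_of_swap : tensor_of b a e :=
  TensorOf swap_pair_inj swap_pair_surj swap_mor_bilin
    (fun B A => tmor1 t A B)
    (fun _ _ _ _ _ _ g g' f f' => tmorM t f f' g g')
    swap_mor_span swap_mor_rel.

End TensorOfSwap.

(** * Slices of a module over a tensor product *)

Section Slices.
Variables (k : comPzRingType) (a b e : lincat k) (t : tensor_of a b e).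

Section SliceFunctor.
Variable B : b.

Let mor A' A (f : lhom A' A) : lhom (tpair t A' B) (tpair t A B) :=
  tmor t f (lid B).

Lemma slice_linear A' A : linear (@mor A' A).
Proof. by have [_ tl] := tmor_bilin t A' A B B; apply: tl. Qed.

Lemma sliceM A'' A' A (f : lhom A' A) (g : lhom A'' A') :
  mor (lcomp f g) = lcomp (mor f) (mor g).
Proof. by rewrite -tmorM lcomp1m. Qed.

Definition slice : linfunctor a e :=
  Linfunctor slice_linear (fun A => tmor1 t A B) sliceM.

End SliceFunctor.

Lemma tmor_slice A' A B' B (f : lhom A' A) (g : lhom B' B) :
  tmor t f g = lcomp (fmor (slice B) f) (tmor t (lid A') g).
Proof. by rewrite -tmorM lcomp1m lcompm1. Qed.

Lemma tmor_sliceC A' A B' B (f : lhom A' A) (g : lhom B' B) :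
  lcomp (tmor t (lid A) g) (fmor (slice B') f) =
  lcomp (fmor (slice B) f) (tmor t (lid A') g).
Proof. by rewrite -!tmorM !lcomp1m !lcompm1. Qed.

Definition spanned A B (R : sieve A) (V : sieve (tpair t A B)) : Prop :=
  forall A' B' (u : lhom (tpair t A' B') (tpair t A B)),
    V _ u <-> exists2 s : seq (lhom A' A * lhom B' B),
      (forall p, p \in s -> R _ p.1) & u = \sum_(p <- s) tmor t p.1 p.2.

Lemma spanned_slice A B (R : sieve A) (V : sieve (tpair t A B)) :
  spanned R V -> forall X (f : lhom X A), R X f -> V _ (fmor (slice B) f).
Proof.
move=> VP X f Rf; apply/VP; exists [:: (f, lid B)]; last by rewrite big_seq1.
by move=> p; rewrite inE => /eqP->.
Qed.

(** If [u] is the sum of the f_i (x) g_i, then u o (h (x) 1) is the sum of the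
    (f_i h (x) 1) o (1 (x) g_i), so the f_i can serve as [hs]. *)
Lemma sieve_slice_pull A B A' B' (u : lhom (tpair t A' B') (tpair t A B))
    (R : sieve A) (V : sieve (tpair t A B)) :
  (forall X (f : lhom X A), R X f -> V _ (fmor (slice B) f)) ->
  exists hs : seq (lhom A' A), forall X (f : lhom X A'),
    multi_pull hs R X f -> V _ (lcomp u (fmor (slice B') f)).
Proof.
move=> RV; have [s ->] := tmor_span (t := t) u; exists (unzip1 s) => X f Rf.
rewrite (lin_sum (lcomp_linl _)); apply: smem_sum => p ps.
rewrite tmor_slice -lcompA tmor_sliceC lcompA.
by apply: smem_comp; rewrite -fmorM; apply/RV/Rf/map_f.
Qed.

Variable F : rmod e.

Let slice_mod B := rmod_restr (slice B) F.

(** The agreement of [h] with [x] is made into a sieve so that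
    [sieve_slice_pull] applies to it. *)
Section AgreeSieve.
Variables (X : e) (V : sieve X) (h : forall Y, lhom Y X -> F Y) (x : F X).
Hypothesis h_comp : compatible V h.

Let mem Y (f : lhom Y X) := V Y f /\ h f = ract F f x.

Lemma agree0 Y : mem (0 : lhom Y X).
Proof.
have V0 := smem0 V Y; split=> //; rewrite (lin0 (ract_linl x)).
have [hl _] := h_comp; have := hl Y (-1) 0 0 V0 V0.
by rewrite scaleN1r oppr0 add0r scaleN1r addNr.
Qed.

Lemma agree_lin Y (z : k) (f g : lhom Y X) : mem f -> mem g -> mem (z *: f + g).
Proof.
move=> [Vf hf] [Vg hg]; split; first exact: smem_lin.
by have [-> //] := h_comp; rewrite hf hg (ract_linl x).
Qed.

Lemma agree_comp Z Y (f : lhom Y X) (g : lhom Z Y) : mem f -> mem (lcomp f g).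
Proof.
move=> [Vf hf]; split; first exact: smem_comp.
by have [_ ->] := h_comp; rewrite // hf ractM.
Qed.

Definition agree_sieve : sieve X := Sieve agree0 agree_lin agree_comp.

End AgreeSieve.

(** If all slices are sheaves for a cover [R], then a sieve [V] that contains
    the f (x) 1 for [f] in [R] is effective: a compatible family on [V] restricts
    to one on [R], whose amalgamation [x] also induces the family on the rest of
    [V].  Indeed, for [w] in [V], both values at [w] agree after composition with
    f (x) 1 for [f] in a finite intersection of pullbacks of [R], for which the
    slices are separated. *)
Lemma eff_top_of_slices A B (R : sieve A) (V : sieve (tpair t A B)) :
  (forall B', eff_top (slice_mod B') R) ->
  (forall X (f : lhom X A), R X f -> V _ (fmor (slice B) f)) ->
  eff_top F V.
Proof.
have pulled A1 A2 (hs : seq (lhom A2 A1)) (S : sieve A1) :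
    (forall B', eff_top (slice_mod B') S) ->
    forall B', eff_top (slice_mod B') (multi_pull hs S).
  by move=> ES B'; apply: multi_pull_cover (eff_top_topology _) _.
(* The hypotheses are stable under pullback, up to replacing [R] by a finite
   intersection; it remains to treat [V] itself. *)
suff main A1 B1 (S : sieve A1) (W : sieve (tpair t A1 B1)) :
    (forall B', eff_top (slice_mod B') S) ->
    (forall X (f : lhom X A1), S X f -> W _ (fmor (slice B1) f)) ->
    separates F W /\ amalgamates F W.
  move=> ER RV; split=> Y; have [A' [B' ->]] := tpair_surj t Y => u;
  have [hs hsP] := sieve_slice_pull u RV;
  by have [] := main _ _ _ (pull_sieve u V) (pulled _ _ hs _ ER) hsP.
move=> ES SW.
have sep B' := sep_top_sep (ES B').1.
split=> [x x0|h hP].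
  by apply: (sep B1) => X f Sf; apply/x0/SW.
have [hl hn] := hP.
have [|x xP] := eff_top_amalg (ES B1) (e := fun X f => h _ (fmor (slice B1) f)).
  split=> [X z f g Sf Sg|Y X f g Sf].
    by rewrite fmor_linear hl //; apply: SW.
  by rewrite fmorM hn //; apply: SW.
exists x => Y; have [A' [B' ->]] := tpair_surj t Y => w Ww.
have [X f Sf|hs hsP] :=
    @sieve_slice_pull _ _ _ _ w S (agree_sieve x hP).
  by split; [exact: SW|exact: xP].
apply: (separates_eq (sep_top_sep (pulled _ _ hs _ ES B').1)) => X f Sf.
have [_] := hsP X f Sf.
by rewrite hn // ractM.
Qed.


Lemma separates_slice A B (R : sieve A) (V : sieve (tpair t A B)) :
  spanned R V -> separates F V -> separates (slice_mod B) R.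
Proof.
move=> VP sV x x0; apply: sV => Y.
have [A' [B' ->]] := tpair_surj t Y => u /VP[s sR ->].
rewrite (lin_sum (ract_linl (x : F (tpair t A B)))) big_seq big1 // => p /sR Rp.
by rewrite tmor_slice ractM [ract F _ x](x0 _ _ Rp) (lin0 (ract_linr _)).
Qed.

Section Extension.
Variables (A : a) (B : b) (R : sieve A).
Variable h : forall A', lhom A' A -> slice_mod B A'.
Hypothesis h_comp : compatible R h.
Hypothesis sepR : forall B' A' (hs : seq (lhom A' A)),
  separates (slice_mod B') (multi_pull hs R).

(** The graph of the extension of [h] to the sieve generated by the f (x) 1,
    for [f] in [R], which sends the sum of the f_i (x) g_i to the sum of the
    h(f_i) . (1 (x) g_i). *)
Inductive ext : forall Y : e, lhom Y (tpair t A B) -> F Y -> Prop :=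
  Ext A' B' (s : seq (lhom A' A * lhom B' B)) :
    (forall p, p \in s -> R _ p.1) ->
    ext (\sum_(p <- s) tmor t p.1 p.2)
      (\sum_(p <- s) ract F (tmor t (lid A') p.2) (h p.1)).

Lemma ext_inv A' B' (u : lhom (tpair t A' B') (tpair t A B)) y : ext u y ->
  exists2 s : seq (lhom A' A * lhom B' B), (forall p, p \in s -> R _ p.1) &
    u = \sum_(p <- s) tmor t p.1 p.2 /\
    y = \sum_(p <- s) ract F (tmor t (lid A') p.2) (h p.1).
Proof.
suff gen Y (w : lhom Y (tpair t A B)) (z : F Y) : ext w z ->
  forall E : Y = tpair t A' B',
  exists2 s : seq (lhom A' A * lhom B' B), (forall p, p \in s -> R _ p.1) &
    ecast X (lhom X (tpair t A B)) E w = \sum_(p <- s) tmor t p.1 p.2 /\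
    ecast X (F X) E z = \sum_(p <- s) ract F (tmor t (lid A') p.2) (h p.1).
  by move=> uy; apply: (gen _ _ _ uy erefl).
case=> {Y w z} A1 B1 s sR E; have [E1 E2] := tpair_inj E.
by subst A1 B1; rewrite (Prop_irrelevance E erefl); exists s.
Qed.

Lemma ext_lin Y (x : k) (u v : lhom Y (tpair t A B)) y z :
  ext u y -> ext v z -> ext (x *: u + v) (x *: y + z).
Proof.
have [A' [B' E]] := tpair_surj t Y; subst Y.
move=> /ext_inv[s sR [-> ->]] /ext_inv[s' s'R [-> ->]].
pose r := [seq (x *: p.1, p.2) | p <- s] ++ s'.
have [hl _] := h_comp.
have rR p : p \in r -> R _ p.1.
  rewrite mem_cat => /orP[/mapP[q qs ->]|/s'R//] /=.
  by rewrite -[_ *: _]addr0; apply: smem_lin; [exact: sR|exact: smem0].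
have := Ext rR; rewrite !big_cat !big_map /= !scaler_sumr.
congr ext; congr (_ + _); apply: eq_big_seq => p /sR Rp.
  have [_ tl] := tmor_bilin t A' A B' B.
  have := tl p.2 x p.1 0; rewrite (lin0 (tl _)) !addr0; exact.
have h0 : h (0 : lhom A' A) = 0.
  have := hl _ (-1) _ _ (smem0 R A') (smem0 R A').
  by rewrite scaleN1r oppr0 add0r scaleN1r addNr.
have := hl _ x _ _ Rp (smem0 R A'); rewrite h0 !addr0 => ->.
have := ract_linr (M := F) (tmor t (lid A') p.2) x (h p.1) 0.
by rewrite (lin0 (ract_linr _)) !addr0.
Qed.

Lemma ext_comp Z Y (u : lhom Y (tpair t A B)) (v : lhom Z Y) y :
  ext u y -> ext (lcomp u v) (ract F v y).
Proof.
have [A' [B' E]] := tpair_surj t Y; subst Y.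
have [A'' [B'' E]] := tpair_surj t Z; subst Z.
have [_ hn] := h_comp.
move=> /ext_inv[s sR [-> ->]]; have [r ->] := tmor_span (t := t) v.
pose q := [seq (lcomp p1.1 p2.1, lcomp p1.2 p2.2) | p1 <- s, p2 <- r].
have qR p : p \in q -> R _ p.1.
  by move=> /allpairsP[[p1 p2] [/= /sR Rp _ ->]] /=; apply: smem_comp.
have := Ext qR; rewrite !big_allpairs_dep /=.
rewrite (lin_sum (lcomp_linl _)) (lin_sum (ract_linr _)).
congr ext; apply: eq_big_seq => p1 /sR Rp1.
  by rewrite (lin_sum (lcomp_linr _)); apply: eq_bigr => p2 _; rewrite tmorM.
rewrite (lin_sum (ract_linl _)); apply: eq_bigr => p2 _.
rewrite hn // /= -!ractM; congr (ract F _ _).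
by rewrite -!tmorM !lcomp1m lcompm1.
Qed.

(** The extension is single-valued at 0.  If the sum of the f_i (x) g_i
    vanishes, then [tens_rel_locality] applied to the submodules
    { g | g o f in R } shows that the value is killed by f (x) 1 for all [f] in a
    finite intersection of pullbacks of [R]. *)
Lemma ext0 Y (y : F Y) : ext (0 : lhom Y (tpair t A B)) y -> y = 0.
Proof.
have [A' [B' E]] := tpair_surj t Y; subst Y.
move=> /ext_inv[s sR [/esym/tmor_rel/tens_rel_locality[hs hsP] ->]].
have [hl hn] := h_comp.
apply: (sepR (B' := B') (hs := hs)) => X f Rf; rewrite /= (lin_sum (ract_linr _)).
have := hsP (F (tpair t X B')) (fun g => R _ (lcomp g f))
  (fun g g' => ract F (tmor t (lid X) g') (h (lcomp g f))).
rewrite big_nil => /(_ _ _ _ _ Rf) K; rewrite -[RHS]K {K}.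
- apply: eq_big_seq => p /sR Rp.
  by rewrite hn //= -!ractM -tmor_sliceC.
- by rewrite (lin0 (lcomp_linl _)); apply: smem0.
- by move=> x m m' Rm Rm'; rewrite lcomp_linl; apply: smem_lin.
- by move=> x m m' n Rm Rm'; rewrite lcomp_linl hl // ract_linr.
- move=> m Rm x n n'.
  have [tr _] := tmor_bilin t X X B' B.
  by rewrite tr ract_linl.
Qed.

Lemma ext_uniq Y (u : lhom Y (tpair t A B)) y z : ext u y -> ext u z -> y = z.
Proof.
move=> uy uz; have := ext_lin (-1) uy uz.
by rewrite !scaleN1r addNr addrC => /ext0/subr0_eq.
Qed.

End Extension.

Lemma amalgamates_slice A B (R : sieve A) (V : sieve (tpair t A B)) :
  spanned R V ->
  (forall B' A' (hs : seq (lhom A' A)),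
    separates (slice_mod B') (multi_pull hs R)) ->
  amalgamates F V -> amalgamates (slice_mod B) R.
Proof.
move=> VP sepR aV h hP.
have extP Y (u : lhom Y (tpair t A B)) : V _ u -> exists y, ext R h u y.
  have [A' [B' E]] := tpair_surj t Y; subst Y.
  by move=> /VP[s sR ->]; exists (\sum_(p <- s) ract F (tmor t (lid A') p.2) (h _ p.1)).
pose w Y (u : lhom Y (tpair t A B)) : F Y :=
  if pselect (V _ u) is left Vu then projT1 (cid (extP _ _ Vu)) else 0.
have wP Y (u : lhom Y (tpair t A B)) : V _ u -> ext R h u (w _ u).
  by rewrite /w; case: pselect => // Vu _; case: cid.
have [|x xP] := aV w.
  split=> [Y x u v Vu Vv|Z Y u v Vu].
    apply: (ext_uniq hP sepR (wP _ _ _)); first exact: smem_lin.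
    by apply: ext_lin => //; apply: wP.
  apply: (ext_uniq hP sepR (wP _ _ _)); first exact: smem_comp.
  by apply: ext_comp => //; apply: wP.
exists x => A' f Rf.
have sR p : p \in [:: (f, lid B)] -> R _ p.1 by rewrite inE => /eqP->.
have Vf : V _ (fmor (slice B) f) := spanned_slice VP Rf.
rewrite /= -xP //.
apply: (ext_uniq hP sepR) (wP _ _ Vf).
have := Ext h sR; rewrite !big_seq1 /= tmor1 ract1; exact.
Qed.

(** Separatedness of all slices comes first: amalgamation in one slice uses
    separatedness of the others, for finite intersections of covers. *)
Lemma slice_sheaf (Ta : cover_system a) (Te : cover_system e) :
  localizing Ta -> localizing Te ->
  (forall A B (R : sieve A), Ta A R ->
     exists2 V : sieve (tpair t A B), Te _ V & spanned R V) ->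
  is_sheaf Te F -> forall B, is_sheaf Ta (slice_mod B).
Proof.
move=> La Le TaV /(localizing_sheafP _ Le) TeF B.
have sep B' A (R : sieve A) : Ta A R -> sep_top (slice_mod B') R.
  have [_ Tp] := La => TR A' u.
  have [V TV VP] := TaV _ B' _ (Tp _ _ u _ TR).
  exact: separates_slice VP (sep_top_sep (TeF _ _ TV).1).
have eff A (R : sieve A) : Ta A R ->
    separates (slice_mod B) R /\ amalgamates (slice_mod B) R.
  move=> TR; split; first exact: sep_top_sep (sep _ _ _ TR).
  have [V TV VP] := TaV _ B _ TR.
  apply: amalgamates_slice VP _ (eff_top_amalg (TeF _ _ TV)) => B' A' hs.
  apply: sep_top_sep; apply: multi_pull_cover (sep_top_topology _) _.
  exact: sep.
by move=> A R /eff/sieve_restr_bijP.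
Qed.

End Slices.

(** * Box sieves *)

Lemma box_sieveP (k : comPzRingType) (a b : lincat k) (A A' : a) (B B' : b)
    (R : sieve A) (S : sieve B) (u : lhom ((A', B') : tcat a b) (A, B)) :
  box_sieve R S (A', B') u <->
  exists2 s : seq (lhom A' A * lhom B' B),
    (forall p, p \in s -> R _ p.1 /\ S _ p.2) &
    u = \sum_(p <- s) tpure p.1 p.2.
Proof.
split=> [[x _ <-]|[s sP ->]].
  exists [seq (sieve_val p.1, sieve_val p.2) | p <- tens_rep x].
    by move=> p /mapP[q _ ->]; split; apply: sieve_atP.
  rewrite big_map -[in LHS](tens_repK x) -sum_tpure.
  rewrite (lin_sum (@box_incl_linear _ _ _ _ _ R S (A', B'))).
  apply: eq_bigr => p _; rewrite /box_incl tmapE //; exact: sieve_val_linear.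
apply: smem_sum => p /sP[Rp Sp].
pose f : sieve_rmod R A' := exist _ p.1 (smem_predP Rp).
pose g : sieve_rmod S B' := exist _ p.2 (smem_predP Sp).
exists (tpure f g) => //.
rewrite /box_incl tmapE //; exact: sieve_val_linear.
Qed.

Section BoxSpanned.
Variables (k : comPzRingType) (a b : lincat k) (A : a) (B : b).

Let t := tensor_of_tcat a b.

Lemma box_sieve_spanned_l (R : sieve A) :
  spanned (t := t) (B := B) R (box_sieve R (max_sieve B)).
Proof.
move=> A' B' u; split=> [/box_sieveP[s sP ->]|[s sP ->]].
  by exists s => // p /sP[].
by apply/box_sieveP; exists s => // p /sP.
Qed.

Lemma box_sieve_spanned_r (S : sieve B) :
  spanned (t := tensor_of_swap t) (B := A) S (box_sieve (max_sieve A) S).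
Proof.
move=> B' A' u; split=> [/box_sieveP[s sP ->]|[s sP ->]].
  exists (swap_seq s); last by rewrite [RHS]big_map.
  by move=> p /mapP[q /sP[_ Sq] ->].
apply/box_sieveP; exists (swap_seq s); last by rewrite [RHS]big_map.
by move=> p /mapP[q /sP Sq ->].
Qed.

End BoxSpanned.

Lemma rmod_ext (k : comPzRingType) (a : lincat k) (V : a -> lmodType k)
    (r r' : forall A' A : a, lhom A' A -> V A -> V A')
    (rb : forall A' A, bilin (@r A' A)) (rb' : forall A' A, bilin (@r' A' A))
    r1 r1' rM rM' :
  (forall A' A (f : lhom A' A) x, r _ _ f x = r' _ _ f x) ->
  Rmod rb r1 rM = Rmod rb' r1' rM'.
Proof.
move=> rr'; have E : r = r'.
  apply: functional_extensionality_dep => A'.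
  apply: functional_extensionality_dep => A.
  by apply: funext => f; apply: funext => x.
by subst r'; congr Rmod; apply: Prop_irrelevance.
Qed.

Section SlicesOfTfun.
Variables (k : comPzRingType) (a b c d : lincat k).
Variables (phi : linfunctor a c) (psi : linfunctor b d) (F : rmod (tcat c d)).

Let tab := tensor_of_tcat a b.
Let tcd := tensor_of_tcat c d.

Lemma rmod_restr_slice_l (B : b) :
  rmod_restr (slice tab B) (rmod_restr (tfun phi psi) F) =
  rmod_restr phi (rmod_restr (slice tcd (psi B)) F).
Proof.
apply: rmod_ext => A' A f x /=; rewrite tfun_morE /=.
by rewrite fmor1.
Qed.

Lemma rmod_restr_slice_r (A : a) :
  rmod_restr (slice (tensor_of_swap tab) A) (rmod_restr (tfun phi psi) F) =
  rmod_restr psi (rmod_restr (slice (tensor_of_swap tcd) (phi A)) F).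
Proof.
apply: rmod_ext => B' B g x /=; rewrite tfun_morE /=.
by rewrite fmor1.
Qed.

End SlicesOfTfun.

Section SheavesOnTensor.
Variables (k : comPzRingType) (a b : lincat k).
Variables (Ta : cover_system a) (Tb : cover_system b).
Hypotheses (La : localizing Ta) (Lb : localizing Tb).
Variable F : rmod (tcat a b).

Let t := tensor_of_tcat a b.

Lemma box_sheafP :
  is_sheaf (box_cover Ta Tb) F <->
  (forall B, is_sheaf Ta (rmod_restr (slice t B) F)) /\
  (forall A, is_sheaf Tb (rmod_restr (slice (tensor_of_swap t) A) F)).
Proof.
have [Lab _] := box_cover_topology Ta Tb.
have [boxl boxr] := box_cover_contains Ta Tb.
split=> [sF|[sl sr]].
  split; apply: (slice_sheaf _ Lab) => //.
    move=> A B R TR; exists (box_sieve R (max_sieve B)); first exact: boxl.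
    exact: box_sieve_spanned_l.
  move=> B A S TS; exists (box_sieve (max_sieve A) S); first exact: boxr.
  exact: box_sieve_spanned_r.
(* The covers form the smallest topology containing the box sieves, so only
   the box sieves have to be tested. *)
apply/localizing_sheafP => // X R; apply; first exact: eff_top_topology.
split=> A B S TS.
  apply: (eff_top_of_slices (t := t)) (spanned_slice (@box_sieve_spanned_l _ _ _ A B S)).
  by move=> B'; have /(localizing_sheafP _ La) := sl B'; apply.
apply: (eff_top_of_slices (t := tensor_of_swap t))
  (spanned_slice (@box_sieve_spanned_r _ _ _ A B S)).
by move=> A'; have /(localizing_sheafP _ Lb) := sr A'; apply.
Qed.

End SheavesOnTensor.

Theorem proposition3p7 (k : comPzRingType) (a b c d : lincat k)
    (Ta : cover_system a) (Tb : cover_system b)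
    (Tc : cover_system c) (Td : cover_system d)
    (phi : linfunctor a c) (psi : linfunctor b d) :
  localizing Ta -> localizing Tb -> localizing Tc -> localizing Td ->
  continuous_functor Ta Tc phi ->
  continuous_functor Tb Td psi ->
  continuous_functor (box_cover Ta Tb) (box_cover Tc Td) (tfun phi psi).
Proof.
move=> La Lb Lc Ld cphi cpsi F /(box_sheafP Lc Ld)[sl sr].
apply/(box_sheafP La Lb); split=> [B|A].
  by rewrite rmod_restr_slice_l; apply: cphi.
by rewrite rmod_restr_slice_r; apply: cpsi.
Qed.
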